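(* Let $k\ge 2$ be an integer. For any odd positive integer $m$, the set $$E_k(m)=\left\{p : p\text{ is an odd prime with } 2k\mid (p-1)\text{ and } p\mid S_{m+\frac{p-1}{k},k}(-1,p)\right\}$$ is finite. Moreover, $E_k(1)=\emptyset$, and if $m\ge 3$ is odd and $p$ is a prime with $p>km+1$, then $p\in E_k(m)$ if and only if $p\equiv 1\pmod{2k}$ and either $$p\ \Big|\ \left((km)!_{(k)}+(km-1)!_{(k)}\right)$$ or $$p\ \Big|\ \left(\frac{(km-kl)!_{(k)}}{(kl)!_{(k)}}+\frac{(km-kl-1)!_{(k)}}{(kl-1)!_{(k)}}\right)\quad\text{for some } l\in\left\{1,\ldots,\tfrac{m-1}{2}\right\}.$$
   Context: For an odd prime $p$ and an integer $k\ge 2$ with $k\mid p-1$, let $\alpha_1,\ldots,\alpha_{(p-1)/k}$ be integers representing the distinct (nonzero) $k$-th power residues modulo $p$. For $n\in\mathbb{N}$ and $d\in\mathbb{Z}$, $$S_{n,k}(d,p)=\det\left[(\alpha_i+d\,\alpha_j)^n\right]_{1\le i,j\le \frac{p-1}{k}}$$ (whether $p$ divides it does not depend on the choice of representatives). For $a,e\in\mathbb{N}$, the $e$-factorial $a!_{(e)}$ is defined recursively by $a!_{(e)}=a\cdot (a-e)!_{(e)}$ if $a>e$, and $a!_{(e)}=a$ if $1\le a\le e$. *)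

(* Defs.v *)
From mathcomp Require Import all_boot all_order all_algebra.
From mathcomp Require Import boolp classical_sets cardinality.

Import GRing.Theory.
Local Open Scope ring_scope.

(* [alpha] lists integers representing, each exactly once, the nonzero
   k-th power residues modulo p. *)
Definition kth_power_residue_reps (k p : nat)
    (alpha : 'I_((p - 1) %/ k) -> int) : Prop :=
  [/\ forall i, ~~ (p %| alpha i)%Z /\
                exists x : int, (alpha i = x ^+ k %[mod p])%Z,
      forall i j, (alpha i = alpha j %[mod p])%Z -> i = j
    & forall a : int, ~~ (p %| a)%Z ->
        (exists x : int, (a = x ^+ k %[mod p])%Z) ->
        exists i, (alpha i = a %[mod p])%Z].

(* The determinant S_{n,k}(d,p), computed from the representatives [alpha]. *)
Definition Sdet (n k : nat) (d : int) (p : nat)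
    (alpha : 'I_((p - 1) %/ k) -> int) : int :=
  \det (\matrix_(i < (p - 1) %/ k, j < (p - 1) %/ k)
          (alpha i + d * alpha j) ^+ n).

(* [alpha p] is the chosen system of representatives modulo p. *)
Definition E (k : nat) (alpha : forall p : nat, 'I_((p - 1) %/ k) -> int)
    (m : nat) : set nat :=
  [set p : nat | [/\ prime p, odd p, (2 * k %| p - 1)%N
    & (p %| Sdet (m + (p - 1) %/ k) k (-1) p (alpha p))%Z]]%classic.

Local Open Scope nat_scope.

(* The first argument is fuel: for e > 0, a recursive calls suffice.  The
   values at a = 0 or e = 0 are irrelevant, as the e-factorial is only
   defined for positive a and e. *)
Fixpoint efact_rec (fuel e a : nat) : nat :=
  if fuel is fuel'.+1 then
    if e < a then a * efact_rec fuel' e (a - e) else a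
  else 1.

Definition efact (e a : nat) : nat := efact_rec a e a.

Notation "a `!_( e )" := (efact e a)
  (at level 2, format "a `!_( e )") : nat_scope.

Lemma efact_rec_fuel (e f g a : nat) :
  0 < e -> 0 < a -> a <= f -> a <= g -> efact_rec f e a = efact_rec g e a.
Proof.
move=> e0; elim: f g a => [|f IH] [|g] [|a] //= _ af ag.
case: ifP => // ea; congr (_ * _).
have h : a.+1 - e <= a by rewrite leq_subLR -add1n leq_add2r.
by apply: IH; rewrite ?subn_gt0 // (leq_trans h).
Qed.

Lemma efactE (e a : nat) : 0 < e -> e < a -> a`!_(e) = a * (a - e)`!_(e).
Proof.
case: a => // a e0 ea; rewrite {1}/efact /= ea; congr (_ * _).
apply: efact_rec_fuel; rewrite ?subn_gt0 //.
by rewrite leq_subLR -add1n leq_add2r.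
Qed.

Lemma efact_small (e a : nat) : 0 < a -> a <= e -> a`!_(e) = a.
Proof. by case: a => // a _ ae; rewrite /efact /= ltnNge ae. Qed.

Lemma efact_dvd (e a j : nat) :
  0 < e -> 0 < a -> a`!_(e) %| (a + j * e)`!_(e).
Proof.
move=> e0 a0; elim: j => [|j IH]; first by rewrite addn0.
have h : a + j.+1 * e = a + j * e + e by rewrite mulSn [e + _]addnC addnA.
have lt : e < a + j * e + e by rewrite -{1}[e]add0n ltn_add2r addn_gt0 a0.
by rewrite h (efactE _ _ e0 lt) addnK dvdn_mull.
Qed.

(* The two quotients in the divisibility criterion are exact, so that
   Euclidean division agrees with division of rational numbers there. *)
Lemma efact_quotients_exact (k m l : nat) :
  2 <= k -> 1 <= l -> l <= (m - 1) %/ 2 ->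
  (k * l)`!_(k) %| (k * m - k * l)`!_(k) /\
  (k * l - 1)`!_(k) %| (k * m - k * l - 1)`!_(k).
Proof.
move=> k2 l1 lm; have k0 : 0 < k by apply: leq_trans k2.
have lm2 : l + l <= m.
  by rewrite addnn -muln2 (leq_trans _ (leq_subr 1 m)) // -leq_divRL.
have h : k * m - k * l = k * l + (m - (l + l)) * k.
  rewrite -mulnBr [_ * k]mulnC -mulnDr; congr (_ * _).
  by rewrite subnDA subnKC // leq_subRL // (leq_trans (leq_addr l l)).
have kl : 1 < k * l by rewrite (leq_trans k2) // leq_pmulr.
split; rewrite h; first by apply: efact_dvd => //; apply: ltnW.
by rewrite -addnBAC ?(ltnW kl) //; apply: efact_dvd; rewrite ?subn_gt0.
Qed.

(* Main.v *)
Require Import Defs.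
From mathcomp Require Import all_boot all_order all_algebra.
From mathcomp Require Import boolp classical_sets cardinality.
From mathcomp Require Import zify ring.

Import GRing.Theory.

(* Put N = (p-1)/k, which is even, and n = m + N with m < N. Modulo p the
   representatives are the N-th roots of unity, so expanding (a_i - a_j)^n and
   reducing exponents mod N factors the matrix as an invertible diagonal matrix
   times V(a^-1)^T C V(a), with V Vandermonde and C diagonal with entries
   +-('C(n, r) + 'C(n, r + N)), r < N. Hence p | S iff one of these vanishes
   mod p. For r > m only 'C(n, r) is left, and it is prime to p since n < p. For
   r <= m the entry is 'C(n, r) + 'C(n, m - r), symmetric under r <-> m - r, and
   k N = -1 mod p turns the binomials into quotients of k-factorials.
   Finiteness follows since the resulting integers are positive and, for given
   m, finitely many. *)

(** * The determinant for a full set of roots of unity in a field *)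

Section Determinant.
Local Open Scope ring_scope.

Lemma det_expr_sub_roots_of_unity (F : fieldType) (N m : nat) (a : 'I_N -> F) :
  (m < N)%N -> ~~ odd N -> (forall i, a i ^+ N = 1) -> injective a ->
  (\det (\matrix_(i, j) (a i - a j) ^+ (m + N)) == 0) =
  [exists r : 'I_N, ('C(m + N, r) + 'C(m + N, r + N))%:R == 0 :> F].
Proof.
move=> mN oddN aN inj_a; set n := (m + N)%N.
have N_gt0 : (0 < N)%N by apply: leq_trans mN.
have a_neq0 i : a i != 0.
  apply: contra_eq_neq (aN i) => ->.
  by rewrite expr0n gtn_eqF // eq_sym oner_eq0.
pose V := Vandermonde N (\row_j a j).
pose W := Vandermonde N (\row_j (a j)^-1).
pose c : 'rV[F]_N := \row_r ((-1) ^+ r * ('C(n, r) + 'C(n, r + N))%:R).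
pose d : 'rV[F]_N := \row_i a i ^+ n.
have detV_neq0 b : injective b ->
    \det (Vandermonde N (\row_(j < N) b j : 'rV[F]_N)) != 0.
  move=> inj_b; rewrite det_Vandermonde.
  apply/prodf_neq0 => i _; apply/prodf_neq0 => j ij; rewrite !mxE subr_eq0.
  by apply: contraTN ij => /eqP/inj_b ->; rewrite ltnn.
have -> : \matrix_(i, j) (a i - a j) ^+ n =
    diag_mx d *m (W^T *m diag_mx c *m V).
  rewrite mul_mx_diag mul_diag_mx; apply/matrixP => i j; rewrite !mxE exprBn mulr_sumr.
  pose f s := (-1) ^+ s * a i ^+ (n - s) * a j ^+ s *+ 'C(n, s).
  (* As n < 2 N, padding the binomial expansion adds only zero terms, and the sum then splits into
     the exponents r and N + r with r < N. *)
  transitivity (\sum_(s < N + N) f s).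
    rewrite -!(big_mkord xpredT f) [RHS](big_cat_nat (n := n.+1)) //=;
      last by rewrite ltn_add2r.
    rewrite [X in _ + X]big_nat_cond [X in _ + X]big1 ?addr0 //.
    move=> s /andP[/andP[ns _] _].
    by rewrite /f bin_small ?mulr0n.
  rewrite big_split_ord /= -big_split /=; apply: eq_bigr => r _; rewrite !mxE /f.
  have an s : (s <= n)%N -> a i ^+ (n - s) = a i ^+ n * (a i)^-1 ^+ s.
    by move=> sn; rewrite exprVn expfB_cond // (negbTE (a_neq0 i)).
  have rn : (r <= n)%N by rewrite (leq_trans (ltnW (ltn_ord r))) // leq_addl.
  (* If N + r > n, the truncated exponent is harmless since both binomials vanish. Otherwise all
     N-th powers drop out, and the sign does too because N is even. *)
  have -> : (-1) ^+ (N + r) * a i ^+ (n - (N + r)) * a j ^+ (N + r) *+ 'C(n, N + r) =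
      (-1) ^+ r * (a i ^+ n * (a i)^-1 ^+ r) * a j ^+ r *+ 'C(n, r + N).
    have [sn | ns] := leqP (N + r) n;
      last by rewrite addnC !bin_small ?mulr0n // addnC.
    rewrite an // [in LHS](exprD _ N r) [in LHS](exprD (a j))
      [in LHS](exprD _^-1) exprVn !aN.
    by rewrite invr1 !mul1r -signr_odd (negbTE oddN) mul1r addnC.
  rewrite an // -mulrnDr -[LHS]mulr_natr.
  rewrite -!mulrA [in RHS](mulrC _ (a j ^+ r)).
  by rewrite [in RHS](mulrCA _ ((-1) ^+ r)) [in RHS](mulrCA (a i ^+ n)).
have detV : \det V != 0 by apply: detV_neq0.
have detW : \det W != 0 by apply: detV_neq0 => i j /invr_inj /inj_a.
rewrite !det_mulmx det_tr !det_diag !mulf_eq0 (negbTE detV) (negbTE detW).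
rewrite orbF /= [X in X || _]negbTE /=; last first.
  by apply/prodf_neq0 => i _; rewrite mxE expf_neq0.
apply/prodf_eq0/existsP => [[r _ r0] | [r r0]]; exists r => //; move: r0;
  by rewrite mxE mulf_eq0 signr_eq0.
Qed.

End Determinant.

(** By Fermat: a representative is some x^k modulo p, and raising it to the power (p-1)/k gives
    x^(p-1) = 1. *)
Lemma kth_power_residue_repsP (k p : nat) (alpha : 'I_((p - 1) %/ k) -> int) :
  prime p -> k %| p - 1 -> kth_power_residue_reps k p alpha ->
  (forall i, ((alpha i)%:~R ^+ ((p - 1) %/ k) = 1 :> 'F_p)%R) /\
  injective (fun i => (alpha i)%:~R%R : 'F_p).
Proof.
move=> p_pr kp [res_alpha inj_alpha _]; have pF := pchar_Fp p_pr.
have eq_mod x y : (x%:~R = y%:~R :> 'F_p)%R <-> (x = y %[mod p])%Z.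
  split=> [/eqP | /eqP].
    by rewrite -subr_eq0 -intrB -(dvdz_pcharf pF) -eqz_mod_dvd => /eqP.
  by rewrite eqz_mod_dvd (dvdz_pcharf pF) intrB subr_eq0 => /eqP.
split=> [i | i j /eq_mod /inj_alpha //].
have [p_ndvd [x /eq_mod def_x]] := res_alpha i.
move: p_ndvd; rewrite (dvdz_pcharf pF) def_x rmorphXn /= -exprM.
rewrite mulnC divnK //; set y : 'F_p := (x%:~R)%R => yk_neq0.
have k_gt0 : 0 < k.
  by rewrite lt0n; apply: contraTneq kp => ->; rewrite dvd0n -lt0n subn_gt0 prime_gt1.
have y_neq0 : (y != 0)%R by move: yk_neq0; rewrite expf_eq0 k_gt0.
(* Multiplying by y leaves y^p = y: Frobenius fixes ['F_p]. *)
apply: (mulfI y_neq0); rewrite -exprS mulr1 subn1 prednK ?prime_gt0 //.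
by rewrite -[y]natr_Zp -(pFrobenius_autE pF) pFrobenius_aut_nat.
Qed.

(** * Quotients of k-factorials and binomials modulo p *)

Lemma efact_mulnS (k a : nat) : 0 < k -> (k * a.+1)`!_(k) = k * a.+1 * (k * a)`!_(k).
Proof.
move=> k0; case: a => [|a]; first by rewrite muln1 muln0 efact_small // muln1.
by rewrite efactE ?ltn_Pmulr //; congr (_ * efact _ _); lia.
Qed.

(** As in the preceding recursion, a = 0 is covered because [efact] takes the value 1 at 0; here
    [k * 0 - 1] truncates to 0. *)
Lemma efact_mulnS_sub1 (k a : nat) :
  1 < k -> (k * a.+1 - 1)`!_(k) = (k * a.+1 - 1) * (k * a - 1)`!_(k).
Proof.
move=> k1; case: a => [|a]; first by rewrite muln1 muln0 efact_small ?muln1; lia.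
by rewrite efactE; [congr (_ * efact _ _)| |]; nia.
Qed.

Lemma efact_mul_gt0 (k a : nat) : 0 < k -> 0 < (k * a)`!_(k).
Proof.
move=> k0; elim: a => [|a IHa]; first by rewrite muln0.
by rewrite efact_mulnS // !muln_gt0 k0.
Qed.

(** The k-factorial of k r is k^r r!, so its product with the binomial is the product of the k (m +
    N - i) for i < r. Since k N = -1, these are k (m - i) - 1, the top r factors of the k-factorial
    of k m - 1. *)
Lemma efact_bin (R : comNzRingType) (k m N r : nat) : 1 < k ->
  ((k * N).+1%:R = 0 :> R)%R -> r <= m ->
  ((k * r)`!_(k) * 'C(m + N, r) * (k * (m - r) - 1)`!_(k))%:R%R
    = (k * m - 1)`!_(k)%:R%R :> R.
Proof.
move=> k1 kN; elim: r => [_ | r IHr rm].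
  by rewrite bin0 muln0 subn0 !mul1n.
rewrite -(IHr (ltnW rm)) efact_mulnS; last exact: ltnW.
rewrite -(subnSK rm) efact_mulnS_sub1 // subnSK //.
(* The new factor k (m + N - r) is written as k (m - r) - 1 plus k N + 1, which vanishes in [R]. *)
have -> : k * r.+1 * (k * r)`!_(k) * 'C(m + N, r.+1)
   = (k * (m - r) - 1 + (k * N).+1) * ((k * r)`!_(k) * 'C(m + N, r)).
  have -> : k * (m - r) - 1 + (k * N).+1 = k * (m + N - r) by nia.
  transitivity (k * (k * r)`!_(k) * (r.+1 * 'C(m + N, r.+1))); first by ring.
  by rewrite mul_bin_left; ring.
by rewrite 3!natrM natrD kN addr0 !natrM; ring.
Qed.

Lemma prime_ndvd_efact (p k a : nat) : prime p -> 1 < k -> k * a < p ->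
  ~~ (p %| (k * a)`!_(k)) && ~~ (p %| (k * a - 1)`!_(k)).
Proof.
move=> p_pr k1; elim: a => [|a IHa] ap.
  by rewrite muln0 !dvdn1 neq_ltn prime_gt1 ?orbT.
rewrite efact_mulnS 1?ltnW // efact_mulnS_sub1 // !Euclid_dvdM // !negb_or.
have /andP[-> ->] : ~~ (p %| (k * a)`!_(k)) && ~~ (p %| (k * a - 1)`!_(k)).
  by apply: IHa; nia.
by rewrite !andbT !gtnNdvd //; nia.
Qed.

Lemma efact_mul_dvd (k a b : nat) : 1 < k -> a <= b ->
  ((k * a)`!_(k) %| (k * b)`!_(k)) && ((k * a - 1)`!_(k) %| (k * b - 1)`!_(k)).
Proof.
move=> k1 /subnKC <-; elim: (b - a) => [|j /andP[IH1 IH2]]; first by rewrite addn0 !dvdnn.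
by rewrite addnS efact_mulnS 1?ltnW // efact_mulnS_sub1 // !dvdn_mull.
Qed.

(** At [l = 0] both denominators are 1, which yields the first alternative of the theorem; the two
    alternatives thus become one family. *)
Definition efact_ratio_sum (k m l : nat) : nat :=
  (k * m - k * l)`!_(k) %/ (k * l)`!_(k) + (k * m - k * l - 1)`!_(k) %/ (k * l - 1)`!_(k).

(** Applying [efact_bin] at r and at m - r gives the same right-hand side, prime to p, so the two
    binomials have a common numerator. The bound on r makes the quotients exact. *)
Lemma dvdn_bin_sum (p k m N r : nat) :
  prime p -> 1 < k -> p = (k * N).+1 -> k * m < p -> r.*2 <= m ->
  (p %| 'C(m + N, r) + 'C(m + N, m - r)) = (p %| efact_ratio_sum k m r).
Proof.
move=> p_pr k1 def_p km r2m; have pF := pchar_Fp p_pr.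
have rm : r <= m by lia.
have kN : ((k * N).+1%:R = 0 :> 'F_p)%R by apply/eqP; rewrite -(dvdn_pcharf pF) -def_p.
have /andP[dvd1 dvd2] : ((k * r)`!_(k) %| (k * (m - r))`!_(k))
    && ((k * r - 1)`!_(k) %| (k * (m - r) - 1)`!_(k)) by apply: efact_mul_dvd => //; lia.
have E1 := efact_bin _ k m N r k1 kN rm.
have E2 := efact_bin _ k m N (m - r) k1 kN (leq_subr r m).
have /andP[f_neq0 g_neq0] := prime_ndvd_efact p k (m - r) p_pr k1 ltac:(nia).
have /andP[_ G_neq0] := prime_ndvd_efact p k m p_pr k1 km.
rewrite /efact_ratio_sum -mulnBr !(dvdn_pcharf pF).
move: E1 E2 f_neq0 g_neq0 G_neq0 dvd1 dvd2; rewrite subKn // !(dvdn_pcharf pF).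
move: ((k * r)`!_(k)) ((k * (m - r))`!_(k)) ((k * r - 1)`!_(k)) ((k * (m - r) - 1)`!_(k)).
move: ((k * m - 1)`!_(k)) ('C(m + N, r)) ('C(m + N, m - r)) => G c1 c2 f1 f2 g1 g2.
move=> E1 E2 f_neq0 g_neq0 G_neq0 /divnK def_f2 /divnK def_g2.
move: (f2 %/ f1) (g2 %/ g1) def_f2 def_g2 => q s def_f2 def_g2.
(* With f2 = q f1 and g2 = s g1, the terms are q (f1 c1 g2) = q G and s (f2 c2 g1) = s G. *)
have E3 : ((f2 * g2)%:R * (c1 + c2)%:R = G%:R * (q + s)%:R :> 'F_p)%R.
  transitivity (q%:R * (f1 * c1 * g2)%:R + s%:R * (f2 * c2 * g1)%:R : 'F_p)%R.
    by rewrite -!natrM -natrD -def_f2 -def_g2; congr (_%:R)%R; ring.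
  by rewrite E1 E2 -mulrDl -natrD mulrC.
have := congr1 (fun x : 'F_p => x == 0%R) E3; rewrite /= !mulf_eq0 (negbTE G_neq0) /=.
by rewrite natrM mulf_eq0 (negbTE f_neq0) (negbTE g_neq0).
Qed.

Lemma prime_ndvd_bin (p n r : nat) : prime p -> n < p -> r <= n -> ~~ (p %| 'C(n, r)).
Proof.
move=> p_pr np rn.
have n_fact : ~~ (p %| n`!).
  elim: n np {rn} => [|n IHn] np; first by rewrite fact0 dvdn1 neq_ltn prime_gt1 ?orbT.
  by rewrite factS Euclid_dvdM // negb_or gtnNdvd // IHn // ltnW.
by apply: contra n_fact; rewrite -(bin_fact rn); apply: dvdn_mulr.
Qed.

(** * The criterion for membership in [E] *)

Lemma dvdz_Sdet (k m p : nat) (alpha : 'I_((p - 1) %/ k) -> int) :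
  prime p -> 2 * k %| p - 1 -> m < (p - 1) %/ k -> kth_power_residue_reps k p alpha ->
  (p %| Sdet (m + (p - 1) %/ k) k (-1)%R p alpha)%Z =
  [exists r : 'I_((p - 1) %/ k),
     p %| 'C(m + (p - 1) %/ k, r) + 'C(m + (p - 1) %/ k, r + (p - 1) %/ k)].
Proof.
move=> p_pr kp mN reps; have pF := pchar_Fp p_pr.
have [|aN inj_a] := kth_power_residue_repsP k p alpha p_pr _ reps.
  by apply: dvdn_trans kp; apply: dvdn_mull.
have evenN : ~~ odd ((p - 1) %/ k).
  have k_gt0 : 0 < k by case: k mN {kp alpha reps aN inj_a} => //; rewrite divn0.
  by rewrite -(divnK kp) mulnA mulnK // oddM andbF.
rewrite (dvdz_pcharf pF) /Sdet -(det_map_mx (intmul 1 : {rmorphism int -> 'F_p})).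
rewrite (_ : map_mx _ _ = \matrix_(i, j)
    ((alpha i)%:~R - (alpha j)%:~R) ^+ (m + (p - 1) %/ k))%R; last first.
  by apply/matrixP => i j; rewrite !mxE /= rmorphXn /= mulN1r intrB.
rewrite det_expr_sub_roots_of_unity //.
by apply/eq_existsb => r; rewrite (dvdn_pcharf pF).
Qed.

(** Allowing [l = 0] and [m = 1] lets all three claims of the theorem follow from this one
    criterion. *)
Lemma mem_E (k m p : nat) (alpha : forall p : nat, 'I_((p - 1) %/ k) -> int) :
  2 <= k -> (forall p : nat, prime p -> odd p -> k %| p - 1 ->
     kth_power_residue_reps k p (alpha p)) ->
  odd m -> prime p -> k * m + 1 < p ->
  E k alpha m p <-> 2 * k %| p - 1 /\
    exists2 l, l <= (m - 1) %/ 2 & p %| efact_ratio_sum k m l.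
Proof.
move=> k2 halpha odd_m p_pr kmp.
have p_odd : 2 * k %| p - 1 -> odd p.
  move=> /dvdnP[q def_p]; move: def_p (prime_gt0 p_pr); rewrite mulnCA.
  by move: (q * k) => u; lia.
have criterion : 2 * k %| p - 1 ->
    (p %| Sdet (m + (p - 1) %/ k) k (-1)%R p (alpha p))%Z <->
    exists2 l, l <= (m - 1) %/ 2 & p %| efact_ratio_sum k m l.
  move=> kkp; have kp : k %| p - 1 by apply: dvdn_trans kkp; apply: dvdn_mull.
  have mN : m < (p - 1) %/ k by rewrite ltn_divRL //; lia.
  rewrite dvdz_Sdet //; last by apply: halpha => //; apply: p_odd.
  move: mN; set N := (p - 1) %/ k => mN.
  have def_p : p = (k * N).+1 by rewrite mulnC divnK // subn1 prednK // prime_gt0.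
  have bin_comp r : r <= m -> 'C(m + N, r + N) = 'C(m + N, m - r).
    by move=> rm; rewrite -bin_sub ?leq_add2r // subnDr.
  have km : k * m < p by lia.
  split=> [/existsP[r] | [l lm]].
    have [rm | mr] := leqP r m; last first.
      (* The remaining binomial is prime to p since m + N < 2 N <= k N < p. *)
      rewrite [X in _ + X]bin_small ?ltn_add2r // addn0.
      have r_lt_N := ltn_ord r.
      by rewrite (negbTE (prime_ndvd_bin p (m + N) r p_pr _ _)) //; nia.
    (* Exchanging r and m - r if necessary gives 2 r <= m, that is r <= (m - 1) / 2 because m is
       odd. *)
    rewrite bin_comp //; have [r2m | r2m] := leqP r.*2 m.
      by rewrite (dvdn_bin_sum p k) // => dvd; exists r => //; lia.
    rewrite addnC -{2}(subKn rm) (dvdn_bin_sum p k) //; last lia.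
    by exists (m - r) => //; lia.
  have lN : l < N by lia.
  rewrite -(dvdn_bin_sum p k m N) // => [dvd|]; last lia.
  by apply/existsP; exists (Ordinal lN); rewrite /= bin_comp //; lia.
split=> [[_ _ kkp /(criterion kkp)] //| [kkp /(criterion kkp) dvd]].
by split=> //; apply: p_odd.
Qed.

Theorem theorem1p13 (k : nat) (hk : 2 <= k)
  (alpha : forall p : nat, 'I_((p - 1) %/ k) -> int)
  (halpha : forall p : nat, prime p -> odd p -> k %| p - 1 ->
     kth_power_residue_reps k p (alpha p)) :
  (forall m : nat, odd m -> finite_set (E k alpha m)) /\
  E k alpha 1 = classical_sets.set0 /\
  (forall m p : nat, 3 <= m -> odd m -> prime p -> k * m + 1 < p ->
     (E k alpha m p <->
      p = 1 %[mod 2 * k] /\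
      (p %| (k * m)`!_(k) + (k * m - 1)`!_(k) \/
       exists l : nat, [/\ 1 <= l, l <= (m - 1) %/ 2
         & p %| (k * m - k * l)`!_(k) %/ (k * l)`!_(k)
                + (k * m - k * l - 1)`!_(k) %/ (k * l - 1)`!_(k)]))).
Proof.
have ratio0 m : efact_ratio_sum k m 0 = (k * m)`!_(k) + (k * m - 1)`!_(k).
  by rewrite /efact_ratio_sum muln0 !subn0 !divn1.
split; last split.
- move=> m odd_m.
  (* Either p <= k m + 1, or p divides one of these positive summands; in both cases p < B + 2. *)
  pose B := k * m + \sum_(l < m) efact_ratio_sum k m l.
  apply: (sub_finite_set _ (finite_II B.+2)) => p Ep /=.
  have p_pr : prime p by case: Ep.
  have [kmp | kmp] := ltnP (k * m + 1) p; last first.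
    by apply: leq_ltn_trans kmp _; rewrite addn1 !ltnS leq_addr.
  have [_ [l lm dvd]] := (mem_E k m p alpha hk halpha odd_m p_pr kmp).1 Ep.
  have l_lt_m : l < m by lia.
  have ratio_gt0 : 0 < efact_ratio_sum k m l.
    have /andP[dvd1 _] := efact_mul_dvd k l (m - l) hk ltac:(lia).
    have gt0 a : 0 < (k * a)`!_(k) by apply: efact_mul_gt0; apply: ltnW.
    by rewrite addn_gt0 -mulnBr divn_gt0 ?(dvdn_leq (gt0 _) dvd1).
  have := dvdn_leq ratio_gt0 dvd; rewrite /B (bigD1 (Ordinal l_lt_m)) //=; lia.
- apply/seteqP; split=> // p Ep; have [p_pr p_odd kkp _] := Ep.
  have kp : k * 1 + 1 < p.
    by have := dvdn_leq (_ : 0 < p - 1) kkp; have := prime_gt1 p_pr; lia.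
  have [_ [[|//] _]] := (mem_E k 1 p alpha hk halpha isT p_pr kp).1 Ep.
  (* Only [l = 0] is left, where the sum is k + (k - 1) = 2 k - 1, positive and below p because 2 k
     divides p - 1. *)
  rewrite ratio0 muln1 !efact_small; try lia.
  move=> /dvdn_leq; have := dvdn_leq (_ : 0 < p - 1) kkp; have := prime_gt1 p_pr; lia.
move=> m p m3 odd_m p_pr kmp; rewrite mem_E //.
have -> : (p = 1 %[mod 2 * k]) <-> 2 * k %| p - 1.
  by rewrite -eqn_mod_dvd ?prime_gt0 //; split=> /eqP.
split=> [[kkp [l lm dvd]] | [kkp [dvd | [l [_ lm dvd]]]]]; split=> //.
- by case: l lm dvd => [|l] lm dvd; [left; rewrite -ratio0 | right; exists l.+1].
- by exists 0; rewrite ?ratio0.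
- by exists l.
Qed.
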